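(* Let $A$ be any $2\times 2$ real symmetric positive definite matrix. Then the function $K(x)=(x^TAx)(x^TA^{-1}x)$ is convex on $\mathbb{R}^2$ if and only if $\kappa(A)\le 3+2\sqrt{2}$.
   Context: $\kappa(A)=\lambda_{\max}(A)/\lambda_{\min}(A)$ denotes the condition number of the positive definite matrix $A$, i.e. the ratio of its largest to its smallest eigenvalue. *)

(* Defs.v *)
From mathcomp Require Export all_boot all_order all_algebra.
From mathcomp Require Export classical_sets reals convex.

Set Implicit Arguments.
Unset Strict Implicit.
Unset Printing Implicit Defensive.

Import Order.TTheory GRing.Theory Num.Theory.

Local Open Scope classical_set_scope.
Local Open Scope ring_scope.

Definition quadratic_form (R : realType) (n : nat) (A : 'M[R]_n)
  (x : 'cV[R]_n) : R := (x^T *m A *m x) 0 0.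

Definition symmetric_posdef (R : realType) (n : nat) (A : 'M[R]_n) : Prop :=
  A^T = A /\ forall x : 'cV[R]_n, x != 0 -> 0 < quadratic_form A x.

(* A matrix has finitely many eigenvalues, so this sup (resp. inf) is a
   maximum (resp. minimum) as soon as there is an eigenvalue in R, which is
   the case for symmetric matrices of positive size. *)
Definition lambda_max (R : realType) (n : nat) (A : 'M[R]_n) : R :=
  sup [set a : R | eigenvalue A a].

Definition lambda_min (R : realType) (n : nat) (A : 'M[R]_n) : R :=
  inf [set a : R | eigenvalue A a].

Lemma lambda_maxE (R : realType) (n : nat) (A : 'M[R]_n) (a : R) :
  eigenvalue A a -> (forall b, eigenvalue A b -> b <= a) -> lambda_max A = a.
Proof.
move=> Aa ub; apply/eqP; rewrite eq_le; apply/andP; split.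
  by apply: ge_sup; [exists a | move=> b /ub].
by apply: ub_le_sup => //; exists a => b /ub.
Qed.

Lemma lambda_minE (R : realType) (n : nat) (A : 'M[R]_n) (a : R) :
  eigenvalue A a -> (forall b, eigenvalue A b -> a <= b) -> lambda_min A = a.
Proof.
move=> Aa lb; apply/eqP; rewrite eq_le; apply/andP; split.
  by apply: ge_inf => //; exists a => b /lb.
by apply: lb_le_inf; [exists a | move=> b /lb].
Qed.

Definition condition_number (R : realType) (n : nat) (A : 'M[R]_n) : R :=
  lambda_max A / lambda_min A.

Definition kantorovich_function (R : realType) (n : nat) (A : 'M[R]_n)
  (x : 'cV[R]_n) : R := quadratic_form A x * quadratic_form (invmx A) x.

(* Main.v *)
From HB Require Import structures.
Require Import Defs.
From mathcomp Require Import all_boot all_order all_algebra.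
From mathcomp Require Import classical_sets reals convex.
From mathcomp Require Import boolp interval_inference ring lra.

Import Order.TTheory GRing.Theory Num.Theory.
Local Open Scope classical_set_scope.
Local Open Scope ring_scope.

(** In an orthonormal eigenbasis of A, with eigenvalues l >= m > 0, the function
    K becomes the binary quartic u^4 + s u^2 v^2 + v^4, where s = k + 1/k and
    k = l/m is the condition number ([kantorovich_diag]; the basis comes from
    [symmetric2_diagonalizable]). Since composing with an invertible linear map
    does not affect convexity, everything reduces to this quartic.

    If 0 <= s <= 6 the quartic is a nonnegative combination of fourth powers of
    linear forms, because u^4 + 6 u^2 v^2 + v^4 is the average of (u + v)^4 and
    (u - v)^4; hence it is convex. If s > 6 it fails to be convex at (1, 1) in
    the direction (1, -1), along which it equals
    (2 + s) + (12 - 2 s) h^2 + (2 + s) h^4. So K is convex exactly when s <= 6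
    ([quartic_convexP]). Finally k + 1/k <= 6 means (k - 3)^2 <= 8, and since
    k >= 1 only the upper bound k <= 3 + 2 sqrt 2 is a constraint. *)

(** * Convex functions on the whole space *)

(** Real weights in place of the bundled type of points of the unit interval. *)
Lemma convex_functionTP (R : realType) (E : lmodType R) (f : E -> R) :
  @convex_function R E [set: E] f <->
  forall (t : R) (x y : E), 0 <= t -> t <= 1 ->
    f (t *: x + (1 - t) *: y) <= t * f x + (1 - t) * f y.
Proof.
split=> [cf t x y t0 t1|cf t x y _ _].
  by have := cf (Itv01 t0 t1) x y; rewrite !in_setT => /(_ isT isT).
by apply: cf; [exact: ge0|exact: le1].
Qed.

Lemma convex_comp_linear {R : realType} {E F : lmodType R}
    (L : {linear E -> F}) {f : F -> R} :
  @convex_function R F [set: F] f ->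
  @convex_function R E [set: E] (fun x => f (L x)).
Proof.
move=> /convex_functionTP cf; apply/convex_functionTP => t x y t0 t1.
by rewrite linearD !linearZ; exact: cf.
Qed.

Lemma convexD {R : realType} {E : lmodType R} {f g : E -> R} :
  @convex_function R E [set: E] f -> @convex_function R E [set: E] g ->
  @convex_function R E [set: E] (fun x => f x + g x).
Proof.
move=> /convex_functionTP cf /convex_functionTP cg.
apply/convex_functionTP => t x y t0 t1.
by have := cf t x y t0 t1; have := cg t x y t0 t1; lra.
Qed.

Lemma convexZ {R : realType} {E : lmodType R} {k : R} {f : E -> R} :
  0 <= k -> @convex_function R E [set: E] f ->
  @convex_function R E [set: E] (fun x => k * f x).
Proof.
move=> k0 /convex_functionTP cf; apply/convex_functionTP => t x y t0 t1.
by have := ler_wpM2l k0 (cf t x y t0 t1); lra.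
Qed.

Lemma sqr_convex {R : realDomainType} {t : R} (a b : R) : 0 <= t -> t <= 1 ->
  (t * a + (1 - t) * b) ^+ 2 <= t * a ^+ 2 + (1 - t) * b ^+ 2.
Proof.
move=> t0 t1; rewrite -subr_ge0.
have -> : t * a ^+ 2 + (1 - t) * b ^+ 2 - (t * a + (1 - t) * b) ^+ 2
          = t * (1 - t) * (a - b) ^+ 2 by ring.
by rewrite mulr_ge0 ?sqr_ge0 // mulr_ge0 // subr_ge0.
Qed.

Lemma pow4_convex (R : realType) :
  @convex_function R R^o [set: R^o] (fun x : R => x ^+ 4).
Proof.
apply/convex_functionTP => t x y t0 t1; rewrite -![_ *: _]/(_ * _).
rewrite !(exprM _ 2 2).
apply: le_trans (sqr_convex _ _ t0 t1).
rewrite ler_sqr ?nnegrE ?sqr_ge0 ?sqr_convex //.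
by rewrite addr_ge0 // mulr_ge0 ?sqr_ge0 ?subr_ge0.
Qed.

(** * The symmetric binary quartic *)

Definition quartic (R : realType) (s : R) (x : 'cV[R]_2) : R :=
  x 0 0 ^+ 4 + s * (x 0 0 ^+ 2 * x 1 0 ^+ 2) + x 1 0 ^+ 4.

Lemma pow4_form_convex (R : realType) (a b : R) :
  @convex_function R 'cV[R]_2 [set: 'cV[R]_2]
    (fun x => (a * x 0 0 + b * x 1 0) ^+ 4).
Proof.
pose L (x : 'cV[R]_2) : R^o := a * x 0 0 + b * x 1 0.
have lL : linear L.
  by move=> k x y; rewrite /L !mxE -[k *: _]/(k * _); ring.
pose M := GRing.isLinear.Build _ _ _ _ L lL.
pose L' : {linear 'cV[R]_2 -> R^o} := HB.pack L M.
exact: (convex_comp_linear L' (@pow4_convex R)).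
Qed.

(** The interval 0 <= s <= 6 has the endpoints u^4 + v^4 and
    ((u + v)^4 + (u - v)^4) / 2, both sums of fourth powers of linear forms; the
    weights 1 - s / 6 and s / 6 interpolate between them. *)
Lemma quartic_convex (R : realType) (s : R) : 0 <= s -> s <= 6 ->
  @convex_function R 'cV[R]_2 [set: 'cV[R]_2] (quartic R s).
Proof.
move=> s0 s6.
have w0 : 0 <= 1 - s / 6 by lra.
have w1 : 0 <= s / 12 by lra.
have cf := convexD
  (convexZ w0 (convexD (pow4_form_convex R 1 0) (pow4_form_convex R 0 1)))
  (convexZ w1 (convexD (pow4_form_convex R 1 1) (pow4_form_convex R 1 (-1)))).
apply/convex_functionTP => t x y t0 t1.
have /convex_functionTP/(_ t x y t0 t1) := cf.
have eqf (z : 'cV[R]_2) : (1 - s / 6) *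
      ((1 * z 0 0 + 0 * z 1 0) ^+ 4 + (0 * z 0 0 + 1 * z 1 0) ^+ 4) +
    s / 12 * ((1 * z 0 0 + 1 * z 1 0) ^+ 4 + (1 * z 0 0 + -1 * z 1 0) ^+ 4)
    = quartic R s z by rewrite /quartic; field.
by rewrite !eqf.
Qed.

Lemma quartic_convex_le6 (R : realType) (s : R) :
  @convex_function R 'cV[R]_2 [set: 'cV[R]_2] (quartic R s) -> s <= 6.
Proof.
move=> /convex_functionTP cf; rewrite leNgt; apply/negP => s6.
(* Midpoint convexity between (1 + h, 1 - h) and (1 - h, 1 + h) says that
   h^2 ((12 - 2 s) + (2 + s) h^2) >= 0. This h lies in ]0, 1[, so
   (s + 2) h^2 < (s + 2) h = s - 6, and the second factor is negative. *)
pose h := (s - 6) / (s + 2).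
have hE : h * (s + 2) = s - 6 by rewrite /h divfK //; lra.
have h0 : 0 < h by rewrite /h divr_gt0; lra.
have h1 : h < 1 by rewrite /h ltr_pdivrMr; lra.
pose p (k : R) : 'cV[R]_2 := \col_i (if i == 0 then 1 + k else 1 - k).
have := cf (2^-1) (p h) (p (- h)) ltac:(lra) ltac:(lra).
rewrite /quartic !mxE /= => ineq.
have {ineq} : 0 <= h ^+ 2 * ((12 - 2 * s) + (2 + s) * h ^+ 2) by lra.
rewrite pmulr_rge0 ?exprn_gt0 //.
have : h ^+ 2 * (s + 2) <= h * (s + 2).
  by rewrite ler_pM2r; [rewrite expr2 ler_piMl; lra|lra].
by rewrite hE; lra.
Qed.

Lemma quartic_convexP (R : realType) (s : R) : 0 <= s ->
  @convex_function R 'cV[R]_2 [set: 'cV[R]_2] (quartic R s) <-> s <= 6.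
Proof.
by move=> s0; split; [exact: quartic_convex_le6|exact: quartic_convex].
Qed.

(** * Orthogonal diagonalization *)

(** The characteristic polynomial has discriminant (a - c)^2 + 4 b^2 >= 0. When
    b != 0, a unit vector (p, q) proportional to (b, l - a) spans the eigenline
    of the larger root l, and (-q, p) spans that of m = a + c - l. *)
Lemma symmetric2_entries (R : rcfType) (a b c : R) :
  exists p q l m : R, [/\ p ^+ 2 + q ^+ 2 = 1, m <= l,
    a = l * p ^+ 2 + m * q ^+ 2, b = (l - m) * (p * q) &
    c = l * q ^+ 2 + m * p ^+ 2].
Proof.
have [->|b0] := eqVneq b 0.
  have [ca|/ltW ac] := leP c a.
    by exists 1, 0, a, c; split=> //; ring.
  by exists 0, 1, c, a; split=> //; ring.
pose D := Num.sqrt ((a - c) ^+ 2 + 4 * b ^+ 2).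
have D0 : 0 <= D by exact: sqrtr_ge0.
have D2 : D ^+ 2 = (a - c) ^+ 2 + 4 * b ^+ 2.
  by rewrite sqr_sqrtr // addr_ge0 ?sqr_ge0 // mulr_ge0 ?sqr_ge0.
pose l := (a + c + D) / 2.
have lE : b ^+ 2 = (l - c) * (l - a) by rewrite /l; lra.
pose n2 := b ^+ 2 + (l - a) ^+ 2; pose n := Num.sqrt n2.
have n2_gt0 : 0 < n2 by rewrite ltr_pwDl ?sqr_ge0 // exprn_even_gt0.
have nn : n ^+ 2 = n2 by rewrite sqr_sqrtr // ltW.
have n0 : n2 != 0 by rewrite gt_eqF.
exists (b / n), ((l - a) / n), l, (a + c - l).
have -> : b / n * ((l - a) / n) = b * (l - a) / n2.
  by rewrite -nn expr2 invfM; ring.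
rewrite !expr_div_n nn; split; first by rewrite -mulrDl divff.
- by rewrite /l; lra.
- rewrite (mulrA l) (mulrA (a + c - l)) -mulrDl.
  by apply: (canRL (mulfK n0)); rewrite /n2 lE; ring.
- rewrite (mulrA (l - _)); apply: (canRL (mulfK n0)).
  by rewrite /n2 lE; ring.
- rewrite (mulrA l) (mulrA (a + c - l)) -mulrDl.
  by apply: (canRL (mulfK n0)); rewrite /n2 lE; ring.
Qed.

Lemma ord2P (i : 'I_2) : i = 0 \/ i = 1.
Proof. by case: i => [[|[|]]] // i2; [left|right]; apply: val_inj. Qed.

Lemma mx2P (R : Type) (A B : 'M[R]_2) :
  A 0 0 = B 0 0 -> A 0 1 = B 0 1 -> A 1 0 = B 1 0 -> A 1 1 = B 1 1 -> A = B.
Proof.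
move=> h00 h01 h10 h11; apply/matrixP => i j.
by case: (ord2P i) => ->; case: (ord2P j) => ->.
Qed.

Definition rotation (R : pzRingType) (p q : R) : 'M[R]_2 :=
  \matrix_(i, j) (if i == 0 then if j == 0 then p else q
                  else if j == 0 then - q else p).

Lemma symmetric2_diagonalizable (R : rcfType) (A : 'M[R]_2) : A^T = A ->
  exists (P : 'M[R]_2) (d : 'rV[R]_2),
    [/\ P *m P^T = 1%:M, d 0 1 <= d 0 0 & A = P^T *m diag_mx d *m P].
Proof.
move=> As.
have A10 : A 1 0 = A 0 1 by rewrite -{1}As mxE.
have [p [q [l [m [pq ml a b c]]]]] :=
  symmetric2_entries R (A 0 0) (A 0 1) (A 1 1).
exists (rotation R p q), (\row_i (if i == 0 then l else m)).
split; last 2 first.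
- by rewrite !mxE.
- rewrite mul_mx_diag.
  by apply: mx2P; rewrite ?A10 ?a ?b ?c !mxE !big_ord_recl big_ord0 !mxE /=;
    ring.
- by apply: mx2P; rewrite !mxE !big_ord_recl big_ord0 !mxE /= -?pq; ring.
Qed.

Section OrthogonalConjugation.
Context {R : realType} {n : nat} {P : 'M[R]_n} (PPt : P *m P^T = 1%:M).

Let PtP : P^T *m P = 1%:M. Proof. exact: mulmx1C. Qed.

Lemma quadratic_form_conj (B : 'M[R]_n) (x : 'cV[R]_n) :
  quadratic_form (P^T *m B *m P) x = quadratic_form B (P *m x).
Proof. by rewrite /quadratic_form trmx_mul !mulmxA. Qed.

Lemma invmx_orthoconj (B : 'M[R]_n) : B \in unitmx ->
  invmx (P^T *m B *m P) = P^T *m invmx B *m P.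
Proof.
move=> Bu; set A := P^T *m B *m P.
have AB : A *m (P^T *m invmx B *m P) = 1%:M.
  by rewrite /A !mulmxA -(mulmxA _ P) PPt mulmx1 mulmxK.
have [Au _] := mulmx1_unit AB.
by rewrite -[RHS](mulKmx Au) AB mulmx1.
Qed.

Lemma kantorovich_conj (B : 'M[R]_n) (x : 'cV[R]_n) : B \in unitmx ->
  kantorovich_function (P^T *m B *m P) x = kantorovich_function B (P *m x).
Proof.
by move=> Bu; rewrite /kantorovich_function invmx_orthoconj //
  !quadratic_form_conj.
Qed.

Lemma eigenvalue_orthoconj_diag (d : 'rV[R]_n) (a : R) :
  eigenvalue (P^T *m diag_mx d *m P) a <-> exists i, a = d 0 i.
Proof.
split=> [/eigenvalueP[v vA v0]|[i ->]].
  pose w := v *m P^T.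
  have w0 : w != 0.
    by apply: contraNneq v0 => w0; rewrite -[v]mulmx1 -PtP mulmxA -/w w0 mul0mx.
  have [i wi] := rV0Pn _ w0; exists i.
  have : w *m diag_mx d = a *: w.
    by rewrite scalemxAl -vA !mulmxA -(mulmxA _ P) PPt mulmx1.
  move=> /rowP/(_ i); rewrite mul_mx_diag mxE [RHS]mxE [RHS]mulrC.
  by move=> /(mulfI wi).
apply/eigenvalueP; exists (delta_mx 0 i *m P).
  rewrite !mulmxA -(mulmxA _ P) PPt mulmx1 scalemxAl; congr (_ *m _).
  apply/rowP => j; rewrite mul_mx_diag !mxE eqxx mulrC.
  by case: eqP => [->|_]; rewrite ?mulr0.
apply/negP => /eqP/(congr1 (mulmx^~ P^T)); rewrite -mulmxA PPt mulmx1 mul0mx.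
by move=> /rowP/(_ i)/eqP; rewrite !mxE !eqxx oner_eq0.
Qed.

End OrthogonalConjugation.

Lemma quadratic_form_diag (R : realType) (n : nat) (d : 'rV[R]_n)
    (x : 'cV[R]_n) :
  quadratic_form (diag_mx d) x = \sum_i d 0 i * x i 0 ^+ 2.
Proof.
rewrite /quadratic_form mul_mx_diag mxE; apply: eq_bigr => i _.
by rewrite !mxE; ring.
Qed.

Lemma posdef_orthoconj_diag_gt0 (R : realType) (n : nat) (P : 'M[R]_n)
    (d : 'rV[R]_n) (i : 'I_n) : P *m P^T = 1%:M ->
  symmetric_posdef (P^T *m diag_mx d *m P) -> 0 < d 0 i.
Proof.
move=> PPt [_ /(_ (P^T *m delta_mx i 0))].
have Px : P *m (P^T *m delta_mx i 0) = delta_mx i 0 :> 'cV[R]_n.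
  by rewrite mulmxA PPt mul1mx.
rewrite quadratic_form_conj Px quadratic_form_diag (bigD1 i) //= big1 => [|j ji].
  rewrite !mxE !eqxx expr1n mulr1 addr0; apply.
  apply/negP => /eqP x0; move: Px; rewrite x0 mulmx0.
  by move=> /colP/(_ i)/eqP; rewrite !mxE !eqxx eq_sym oner_eq0.
by rewrite !mxE (negPf ji) expr0n mulr0.
Qed.

(** * The theorem in the eigenbasis *)

Lemma diag_mx_unit (R : fieldType) (n : nat) (d : 'rV[R]_n) :
  (forall i, d 0 i != 0) -> diag_mx d \in unitmx.
Proof. by move=> d0; rewrite unitmxE det_diag unitfE; apply/prodf_neq0. Qed.

Lemma invmx_diag (R : fieldType) (n : nat) (d : 'rV[R]_n) :
  (forall i, d 0 i != 0) ->
  invmx (diag_mx d) = diag_mx (\row_i (d 0 i)^-1).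
Proof.
move=> d0; rewrite -[RHS](mulKmx (diag_mx_unit _ _ _ d0)) mulmx_diag.
rewrite (_ : (\row_i _) = const_mx 1) ?diag_const_mx ?mulmx1 //.
by apply/rowP => i; rewrite !mxE divff.
Qed.

Lemma kantorovich_diag (R : realType) (d : 'rV[R]_2) (x : 'cV[R]_2) :
  (forall i, d 0 i != 0) ->
  kantorovich_function (diag_mx d) x =
  quartic R (d 0 0 / d 0 1 + (d 0 0 / d 0 1)^-1) x.
Proof.
move=> d0; rewrite /kantorovich_function invmx_diag // !quadratic_form_diag.
rewrite !big_ord_recl !big_ord0 !mxE (_ : lift 0 0 = 1); last exact: val_inj.
by rewrite /quartic; field; rewrite !d0.
Qed.

Lemma condition_number_orthoconj_diag (R : realType) (P : 'M[R]_2)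
    (d : 'rV[R]_2) : P *m P^T = 1%:M -> d 0 1 <= d 0 0 ->
  condition_number (P^T *m diag_mx d *m P) = d 0 0 / d 0 1.
Proof.
move=> PPt d10; rewrite /condition_number.
have eigP := eigenvalue_orthoconj_diag PPt d.
rewrite (lambda_maxE (a := d 0 0)) ?(lambda_minE (a := d 0 1)) //.
- by apply/eigP; exists 1.
- by move=> b /eigP[i ->]; case: (ord2P i) => ->.
- by apply/eigP; exists 0.
- by move=> b /eigP[i ->]; case: (ord2P i) => ->.
Qed.

Lemma add_inv_le6 (R : rcfType) (k : R) : 1 <= k ->
  k + k^-1 <= 6 <-> k <= 3 + 2 * Num.sqrt 2.
Proof.
move=> k1; have k0 : 0 < k by lra.
have s0 : 0 <= Num.sqrt 2 :> R by exact: sqrtr_ge0.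
have s2 : Num.sqrt 2 ^+ 2 = 2 :> R by exact: sqr_sqrtr.
have kV : (k + k^-1 <= 6) = ((k - 3) ^+ 2 <= (2 * Num.sqrt 2) ^+ 2).
  rewrite -(ler_pM2r k0) mulrDl mulVf ?gt_eqF // exprMn s2.
  by apply/idP/idP; lra.
rewrite kV; split=> h.
  have [//|lt] := leP k (3 + 2 * Num.sqrt 2).
  suff : (2 * Num.sqrt 2) ^+ 2 < (k - 3) ^+ 2 by rewrite ltNge h.
  by rewrite ltr_sqr ?nnegrE; lra.
(* The lower bound -2 sqrt 2 <= k - 3 follows from k >= 1 and 1 <= sqrt 2. *)
have s1 : 1 <= Num.sqrt 2 :> R by rewrite -[leLHS]sqrtr1 ler_wsqrtr // ler1n.
by rewrite -subr_ge0 subr_sqr mulr_ge0; lra.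
Qed.

Theorem theorem3p1 (R : realType) (A : 'M[R]_2) (hA : symmetric_posdef A) :
  @convex_function R 'cV[R]_2 [set: 'cV[R]_2] (kantorovich_function A) <->
  condition_number A <= 3 + 2 * Num.sqrt 2.
Proof.
have [P [d [PPt d10 AE]]] := symmetric2_diagonalizable R A (proj1 hA).
have d_gt0 i : 0 < d 0 i.
  by apply: (posdef_orthoconj_diag_gt0 R 2 P) => //; rewrite -AE.
have d0 i : d 0 i != 0 by rewrite gt_eqF.
rewrite AE condition_number_orthoconj_diag //.
set k := d 0 0 / d 0 1.
have k1 : 1 <= k by rewrite ler_pdivlMr // mul1r.
have KE x : kantorovich_function (P^T *m diag_mx d *m P) x =
    quartic R (k + k^-1) (P *m x).
  by rewrite kantorovich_conj ?diag_mx_unit // kantorovich_diag.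
have s0 : 0 <= k + k^-1 by rewrite addr_ge0 ?invr_ge0 //; lra.
rewrite -add_inv_le6 // -quartic_convexP //; split=> [cK|cq].
  have := convex_comp_linear (mulmx P^T) cK.
  congr (convex_function _); apply/funext => x.
  by rewrite KE mulmxA PPt mul1mx.
by rewrite (funext KE); exact: (convex_comp_linear (mulmx P) cq).
Qed.
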